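(* Let $M$ be a smooth, connected, orientable $n$-dimensional manifold ($n\ge 2$), let $F=(f_1,\ldots,f_{n-2}):M\to\mathbb{R}^{n-2}$ be a surjective submersion with compact and connected fibers, and let $X,Y$ be everywhere linearly independent smooth vector fields on $M$ that are tangent to the fibers of $F$. Then $X$ is B-integrable (with $k=2$) if one of the following conditions is satisfied: (i) there exist $g,h\in\mathcal{C}^{\infty}(M)$, with $h$ never vanishing, such that $[X,Y]=gY$ and $X(h)=-gh$; (ii) there exist $g,h\in\mathcal{C}^{\infty}(M)$, with $h$ never vanishing, such that $[X,Y]=gX$ and $X(h)=-g$.
   Context: All objects are smooth; $\mathcal{L}_X$ denotes the Lie derivative along $X$, and $X(h)=\mathcal{L}_Xh$; $\mathbb{R}^0$ is a point. B-integrable ($k=2$): a vector field $X$ on an $n$-dimensional manifold $M$ is B-integrable (with two-dimensional fibers) if there is a surjective submersion $F=(f_1,\dots,f_{n-2}):M\to\mathbb{R}^{n-2}$ with compact and connected fibers such that $\mathcal{L}_Xf_\alpha=0$ for all $\alpha=1,\dots,n-2$, and there are two everywhere linearly independent smooth vector fields $Y_1,Y_2$ on $M$ such that $[Y_i,X]=0$ for $i=1,2$, $[Y_1,Y_2]=0$, and $\mathcal{L}_{Y_i}f_\alpha=0$ for all $i=1,2$ and $\alpha=1,\dots,n-2$. *)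

(* Defs.v *)
From HB Require Import structures.
From mathcomp Require Import all_boot all_order all_algebra.
From mathcomp Require Import all_classical all_reals all_analysis.
Set Implicit Arguments.
Unset Strict Implicit.
Unset Printing Implicit Defensive.
Import Order.TTheory GRing.Theory Num.Theory.
Import numFieldNormedType.Exports.
Local Open Scope classical_set_scope.
Local Open Scope ring_scope.

(* Meaningful for an open set [U]: the derivatives at a point of [U] are
   two-sided. The directions [v] range over all vectors and not only over a
   basis, which in finite dimension gives the same notion of C^k. *)
Fixpoint Ck_on (R : realType) (V W : normedModType R) (k : nat)
    (U : set V) (f : V -> W) : Prop :=
  (forall x, U x -> {for x, continuous f}) /\
  match k with
  | 0 => True
  | k'.+1 => (forall x v, U x -> derivable f x v) /\
             (forall v, Ck_on k' U ('D_v f))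
  end.

Definition smooth_on (R : realType) (V W : normedModType R)
  (U : set V) (f : V -> W) : Prop := forall k, Ck_on k U f.

(* [chart_inv] is total, but only its values on [chart_cod c] matter. *)
Record chart (R : realType) (n : nat) (M : topologicalType) := Chart {
  chart_dom : set M;
  chart_map :> M -> 'rV[R]_n;
  chart_inv : 'rV[R]_n -> M;
  chart_open_dom : open chart_dom;
  chart_open_cod : open (chart_map @` chart_dom);
  chart_mapK : forall p, chart_dom p -> chart_inv (chart_map p) = p;
  chart_map_continuous :
    forall p, chart_dom p -> {for p, continuous chart_map};
  chart_inv_continuous :
    forall x, (chart_map @` chart_dom) x -> {for x, continuous chart_inv} }.

Definition chart_cod (R : realType) (n : nat) (M : topologicalType)
  (c : chart R n M) : set 'rV[R]_n := c @` chart_dom c.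

(* The transition map from [c] to [d] is [d \o chart_inv c] restricted to
   [transition_dom c d]. *)
Definition transition_dom (R : realType) (n : nat) (M : topologicalType)
  (c d : chart R n M) : set 'rV[R]_n := c @` (chart_dom c `&` chart_dom d).

Definition compatible (R : realType) (n : nat) (M : topologicalType)
    (c d : chart R n M) : Prop :=
  smooth_on (transition_dom c d) (d \o chart_inv c) /\
  smooth_on (transition_dom d c) (c \o chart_inv d).

(* The atlas need not be maximal. *)
Record manifold (R : realType) (n : nat) := Manifold {
  mfd_space :> topologicalType;
  mfd_hausdorff : hausdorff_space mfd_space;
  mfd_second_countable : @second_countable mfd_space;
  atlas : set (chart R n mfd_space);
  atlas_cover : forall p : mfd_space, exists2 c, atlas c & chart_dom c p;
  atlas_compatible : forall c d, atlas c -> atlas d -> compatible c d }.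

Definition orientable (R : realType) (n : nat) (M : manifold R n) : Prop :=
  exists A : set (chart R n M),
    [/\ forall p : M, exists2 c, A c & chart_dom c p,
        forall c d, A c -> atlas d -> compatible c d &
        forall c d, A c -> A d -> forall x, transition_dom c d x ->
          0 < \det ('J (d \o chart_inv c) x)].

Definition smooth_map (R : realType) (n : nat) (M : manifold R n)
    (W : normedModType R) (f : M -> W) : Prop :=
  forall c, atlas c -> smooth_on (chart_cod c) (f \o chart_inv c).

Definition smooth_fun (R : realType) (n : nat) (M : manifold R n)
  (f : M -> R) : Prop := smooth_map f.

(* Tangent vectors at [p] are derivations at [p] of the algebra of smooth
   functions; a tangent vector is thus determined by its values on smooth
   functions, its values on other functions being irrelevant. *)
Record tangent (R : realType) (n : nat) (M : manifold R n) (p : M) := Tangent {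
  tangent_app :> (M -> R) -> R;
  tangent_linear : forall (a : R) (f g : M -> R),
    smooth_fun f -> smooth_fun g ->
    tangent_app (fun q => a * f q + g q) = a * tangent_app f + tangent_app g;
  tangent_leibniz : forall f g : M -> R, smooth_fun f -> smooth_fun g ->
    tangent_app (fun q => f q * g q) =
      tangent_app f * g p + f p * tangent_app g }.

Record vector_field (R : realType) (n : nat) (M : manifold R n) := VectorField {
  vf_at :> forall p : M, tangent p;
  vf_smooth : forall f : M -> R, smooth_fun f ->
    smooth_fun (fun p => vf_at p f) }.

Definition lie_deriv (R : realType) (n : nat) (M : manifold R n)
  (X : vector_field M) (f : M -> R) : M -> R := fun p => X p f.

Definition lie_bracket (R : realType) (n : nat) (M : manifold R n)
    (X Y : vector_field M) (f : M -> R) : M -> R :=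
  fun p => lie_deriv X (lie_deriv Y f) p - lie_deriv Y (lie_deriv X f) p.

(* [X] and [Y] are linearly independent in the tangent space at every point. *)
Definition everywhere_independent (R : realType) (n : nat) (M : manifold R n)
    (X Y : vector_field M) : Prop :=
  forall (p : M) (a b : R),
    (forall f, smooth_fun f -> a * X p f + b * Y p f = 0) -> a = 0 /\ b = 0.

Definition component (R : realType) (T : Type) (k : nat)
  (F : T -> 'rV[R]_k) (i : 'I_k) : T -> R := fun p => F p ord0 i.

Definition differential (R : realType) (n k : nat) (M : manifold R n)
    (F : M -> 'rV[R]_k) (p : M) (v : tangent p) : 'rV[R]_k :=
  \row_i v (component F i).

Definition submersion (R : realType) (n k : nat) (M : manifold R n)
    (F : M -> 'rV[R]_k) : Prop :=
  smooth_map F /\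
  forall (p : M) (w : 'rV[R]_k), exists v : tangent p, differential F v = w.

Definition fiber (R : realType) (T : Type) (k : nat)
  (F : T -> 'rV[R]_k) (c : 'rV[R]_k) : set T := F @^-1` [set c].

Definition compact_connected_submersion (R : realType) (n k : nat)
    (M : manifold R n) (F : M -> 'rV[R]_k) : Prop :=
  [/\ submersion F,
      forall c, exists p, F p = c,
      forall c, compact (fiber F c) &
      forall c, connected (fiber F c)].

Definition smooth_curve (R : realType) (n : nat) (M : manifold R n)
    (e : R) (gamma : R -> M) : Prop :=
  (forall t, t \in `]-e, e[ -> {for t, continuous gamma}) /\
  forall c : chart R n M, atlas c ->
    smooth_on ([set` `]-e, e[] `&` gamma @^-1` chart_dom c) (c \o gamma).

(* [v] is the velocity at time 0 of a smooth curve through [p] inside [S]. *)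
Definition tangent_to (R : realType) (n : nat) (M : manifold R n)
    (S : set M) (p : M) (v : tangent p) : Prop :=
  exists (e : R) (gamma : R -> M),
    [/\ 0 < e, smooth_curve e gamma, gamma 0 = p,
        forall t, t \in `]-e, e[ -> S (gamma t) &
        forall f, smooth_fun f -> v f = derive1 (f \o gamma) 0].

Definition tangent_to_fibers (R : realType) (n k : nat) (M : manifold R n)
    (F : M -> 'rV[R]_k) (X : vector_field M) : Prop :=
  forall p : M, tangent_to (fiber F (F p)) (X p).

(* Intended for 2 <= n; the subtraction is truncated. *)
Definition B_integrable (R : realType) (n : nat) (M : manifold R n)
    (X : vector_field M) : Prop :=
  exists F : M -> 'rV[R]_(n - 2),
    [/\ compact_connected_submersion F,
        forall i, lie_deriv X (component F i) = cst 0 &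
        exists Y1 Y2 : vector_field M,
          [/\ everywhere_independent Y1 Y2,
              forall f, smooth_fun f -> lie_bracket Y1 X f = cst 0,
              forall f, smooth_fun f -> lie_bracket Y2 X f = cst 0,
              forall f, smooth_fun f -> lie_bracket Y1 Y2 f = cst 0 &
              forall i, lie_deriv Y1 (component F i) = cst 0 /\
                        lie_deriv Y2 (component F i) = cst 0]].

(* Main.v *)
(* Multiply the bracket relation by the integrating factor [h]: in case (i)
   [X, h Y] = (X(h) + g h) Y = 0, and in case (ii)
   [X, Y + h X] = (g + X(h)) X = 0.  So [X] commutes with itself and with
   [h Y], resp. [Y + h X], and the submersion [F] can be kept. *)
Require Import Defs.
From mathcomp Require Import all_boot all_order all_algebra.
From mathcomp Require Import all_classical all_reals all_analysis.
Import Order.TTheory GRing.Theory Num.Theory.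
Import numFieldNormedType.Exports.
Local Open Scope classical_set_scope.
Local Open Scope ring_scope.

Section SmoothOn.
Set Implicit Arguments.
Unset Strict Implicit.
Context {R : realType} {V : normedModType R}.

Lemma Ck_on_le (W : normedModType R) k (U : set V) (f : V -> W) :
  Ck_on k.+1 U f -> Ck_on k U f.
Proof.
elim: k f => [|k IH] f [cf [df Df]]; first by split.
by split=> //; split=> // v; apply/IH/Df.
Qed.

(** As [U] is open, agreement on [U] is agreement near each of its points, so continuity and
    directional derivatives carry over and the derivatives again agree on [U]. This is needed
    because the rules for derivatives below hold only at points of [U]. *)
Lemma eq_Ck_on (W : normedModType R) k (U : set V) (f g : V -> W) :
  open U -> (forall x, U x -> f x = g x) -> Ck_on k U f -> Ck_on k U g.
Proof.
move=> oU; elim: k f g => [|k IH] f g fg [cf Hf];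
  (have nfg x (Ux : U x) : \near x, f x = g x
    by (near do apply: fg; exact: open_nbhs_nbhs));
  (split; first by move=> x Ux; rewrite /prop_for /continuous_at -(fg _ Ux);
     apply: cvg_trans (cf x Ux); apply: near_eq_cvg; exact: nfg) => //.
case: Hf => df Df.
split=> [x v Ux|v]; first exact/(near_eq_derivable (nfg x Ux))/df.
by apply: IH (Df v) => x Ux; exact/near_eq_derive/nfg.
Unshelve. all: by end_near. Qed.

Lemma Ck_onD (W : normedModType R) k (U : set V) (f g : V -> W) :
  open U -> Ck_on k U f -> Ck_on k U g -> Ck_on k U (f + g).
Proof.
move=> oU; elim: k f g => [|k IH] f g [cf Hf] [cg Hg];
  (split; first by move=> x Ux; apply: cvgD; [exact: cf|exact: cg]) => //.
case: Hf => df Df; case: Hg => dg Dg.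
split=> [x v Ux|v]; first by apply: derivableD; [exact: df|exact: dg].
apply: eq_Ck_on (IH _ _ (Df v) (Dg v)) => // x Ux.
by rewrite deriveD//; [exact: df|exact: dg].
Qed.

Lemma Ck_onM k (U : set V) (f g : V -> R) :
  open U -> Ck_on k U f -> Ck_on k U g -> Ck_on k U (f * g).
Proof.
move=> oU; elim: k f g => [|k IH] f g Hf Hg;
  (split; first by move=> x Ux; apply: cvgM; [exact: Hf.1|exact: Hg.1]) => //.
have [_ [df Df]] := Hf; have [_ [dg Dg]] := Hg.
split=> [x v Ux|v]; first by apply: derivableM; [exact: df|exact: dg].
(* The product rule keeps one factor undifferentiated; that factor is lowered from order [k.+1] to
   [k] to fit the induction hypothesis. *)
have := Ck_onD oU (IH _ _ (Ck_on_le Hf) (Dg v)) (IH _ _ (Ck_on_le Hg) (Df v)).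
apply: eq_Ck_on => // x Ux.
by rewrite deriveM//; [exact: df|exact: dg].
Qed.

Lemma Ck_on_coord m n k (U : set V) (f : V -> 'M[R]_(m, n)) i j :
  open U -> Ck_on k U f -> Ck_on k U (fun x => f x i j).
Proof.
move=> oU; elim: k f => [|k IH] f [cf Hf];
  (split; first by move=> x Ux;
     exact: (continuous_comp (cf x Ux) (@coord_continuous _ _ _ i j _))) => //.
case: Hf => df Df.
split=> [x v Ux|v]; first by have /derivable_mxP := df x v Ux; exact.
apply: eq_Ck_on (IH _ (Df v)) => // x Ux.
by rewrite derive_mx ?mxE//; exact: df.
Qed.

End SmoothOn.

Section VectorFields.
Set Implicit Arguments.
Unset Strict Implicit.
Context {R : realType} {n : nat} {M : manifold R n}.
Implicit Types (f g h : M -> R) (X Y Z : vector_field M).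

Lemma smooth_funD f g :
  smooth_fun f -> smooth_fun g -> smooth_fun (fun p => f p + g p).
Proof.
move=> sf sg c ac k; have oc : open (chart_cod c) by exact: chart_open_cod.
exact: Ck_onD oc (sf c ac k) (sg c ac k).
Qed.

Lemma smooth_funM f g :
  smooth_fun f -> smooth_fun g -> smooth_fun (fun p => f p * g p).
Proof.
move=> sf sg c ac k; have oc : open (chart_cod c) by exact: chart_open_cod.
exact: Ck_onM oc (sf c ac k) (sg c ac k).
Qed.

Lemma smooth_component k (F : M -> 'rV[R]_k) i :
  smooth_map F -> smooth_fun (component F i).
Proof.
move=> sF c ac m; have oc : open (chart_cod c) by exact: chart_open_cod.
exact: Ck_on_coord oc (sF c ac m).
Qed.

Lemma tangentD (p : M) (v : tangent p) f g : smooth_fun f -> smooth_fun g ->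
  v (fun q => f q + g q) = v f + v g.
Proof.
move=> sf sg; have := tangent_linear v 1 sf sg.
by rewrite mul1r => <-; congr (v _); apply/funext => q; rewrite mul1r.
Qed.

(** A curve inside the fiber keeps each component of [F] constant, so its velocity annihilates that
    component. *)
Lemma tangent_to_fiber_component k (F : M -> 'rV[R]_k) p (v : tangent p) i :
  smooth_map F -> tangent_to (fiber F (F p)) v -> v (component F i) = 0.
Proof.
move=> sF [e [gamma [e0 _ _ gF vE]]].
rewrite vE; last exact: smooth_component.
(* The curve is known to stay in the fiber only for times in []-e, e[], hence a constant near 0
   rather than everywhere. *)
rewrite derive1E (@near_eq_derive _ _ _ _ (cst (F p ord0 i))) ?derive_cst//.
near=> t; rewrite /= /component (gF t)//.
rewrite in_itv/=; near: t.
have : 0 \in `]-e, e[ by rewrite in_itv/= oppr_lt0 e0.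
by move=> /near_in_itvoo; apply: filterS => t; rewrite in_itv.
Unshelve. all: by end_near. Qed.

(** The proof [sh] is an argument because the last obligation, that smooth functions are sent to
    smooth functions, depends on it. *)
Program Definition scale_vf h (sh : smooth_fun h) X : vector_field M :=
  @VectorField R n M (fun p => @Tangent R n M p (fun f => h p * X p f) _ _) _.
Next Obligation.
by move=> h sh X p a f g sf sg /=; rewrite tangent_linear// mulrDr mulrCA.
Qed.
Next Obligation.
move=> h sh X p f g sf sg.
by rewrite /= tangent_leibniz// mulrDr mulrA [h p * (f p * _)]mulrCA.
Qed.
Next Obligation.
by move=> h sh X f sf /=; apply: smooth_funM => //; exact: vf_smooth.
Qed.

Program Definition add_vf X Y : vector_field M :=
  @VectorField R n M (fun p => @Tangent R n M p (fun f => X p f + Y p f) _ _) _.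
Next Obligation.
by move=> X Y p a f g sf sg /=; rewrite !tangent_linear// mulrDr addrACA.
Qed.
Next Obligation.
by move=> X Y p f g sf sg /=; rewrite !tangent_leibniz// mulrDr mulrDl addrACA.
Qed.
Next Obligation.
by move=> X Y f sf /=; apply: smooth_funD; exact: vf_smooth.
Qed.

Lemma lie_bracket_self X f : lie_bracket X X f = cst 0.
Proof. by apply/funext => p; rewrite /lie_bracket subrr. Qed.

Lemma lie_bracketC X Y f p : lie_bracket X Y f p = - lie_bracket Y X f p.
Proof. by rewrite /lie_bracket opprB. Qed.

(** The Leibniz rule for [X] on the product of [h] and [Y f] yields the extra term; in the other
    half of the bracket [h] is merely a factor. *)
Lemma lie_bracket_scale X Y h (sh : smooth_fun h) f p : smooth_fun f ->
  lie_bracket X (scale_vf sh Y) f p =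
    lie_deriv X h p * lie_deriv Y f p + h p * lie_bracket X Y f p.
Proof.
move=> sf; rewrite /lie_bracket /lie_deriv /= tangent_leibniz//.
  by rewrite mulrBr addrA.
exact: vf_smooth.
Qed.

Lemma lie_bracket_add X Y Z f p : smooth_fun f ->
  lie_bracket X (add_vf Y Z) f p = lie_bracket X Y f p + lie_bracket X Z f p.
Proof.
move=> sf; rewrite /lie_bracket /lie_deriv /= tangentD; try exact: vf_smooth.
by rewrite opprD addrACA.
Qed.

End VectorFields.

(** Shared end of both cases: [X] itself serves as [Y1], so only one further field [Z] commuting
    with [X] has to be found. *)
Lemma commuting_B_integrable (R : realType) (n : nat) (M : manifold R n)
    (F : M -> 'rV[R]_(n - 2)) (X Z : vector_field M) :
  compact_connected_submersion F -> everywhere_independent X Z ->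
  (forall f, smooth_fun f -> forall p, lie_bracket X Z f p = 0) ->
  (forall i p, X p (component F i) = 0) ->
  (forall i p, Z p (component F i) = 0) ->
  B_integrable X.
Proof.
move=> FF XZ comm XF ZF; exists F; split=> // [i|]; first exact/funext/XF.
exists X, Z; split=> // [f _|f sf|f sf|i].
- exact: lie_bracket_self.
- by apply/funext => p; rewrite lie_bracketC comm// oppr0.
- exact/funext/comm.
- by split; apply/funext => p; [exact: XF|exact: ZF].
Qed.

Theorem proposition2 (R : realType) (n : nat) (hn : (2 <= n)%N)
  (M : manifold R n) (hconn : connected [set: M]) (horient : orientable M)
  (F : M -> 'rV[R]_(n - 2)) (hF : compact_connected_submersion F)
  (X Y : vector_field M) (hindep : everywhere_independent X Y)
  (hX : tangent_to_fibers F X) (hY : tangent_to_fibers F Y)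
  (hcond :
    (exists g h : M -> R,
      [/\ smooth_fun g, smooth_fun h, forall p, h p != 0,
          forall f, smooth_fun f ->
            lie_bracket X Y f = (fun p => g p * lie_deriv Y f p) &
          lie_deriv X h = (fun p => - (g p * h p))])
    \/
    (exists g h : M -> R,
      [/\ smooth_fun g, smooth_fun h, forall p, h p != 0,
          forall f, smooth_fun f ->
            lie_bracket X Y f = (fun p => g p * lie_deriv X f p) &
          lie_deriv X h = (fun p => - g p)])) :
  B_integrable X.
Proof.
have [[sF _] _ _ _] := hF.
have XF i p : X p (component F i) = 0 := tangent_to_fiber_component i sF (hX p).
have YF i p : Y p (component F i) = 0 := tangent_to_fiber_component i sF (hY p).
case: hcond => -[g [h [_ sh h0 XY Xh]]].
- apply: (@commuting_B_integrable R n M F X (scale_vf sh Y)) => //.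
  (* A relation between [X] and [h Y] is one between [X] and [Y] with coefficients [a] and [b h];
     since [h p] is nonzero, [b] vanishes. *)
  + move=> p a b ab; have [f sf|-> /eqP] := hindep p a (b * h p).
      by rewrite -mulrA; exact: ab.
    by rewrite mulf_eq0 (negbTE (h0 p)) orbF => /eqP.
  (* The two terms are [- g h Y f] and [h g Y f]. *)
  + move=> f sf p; rewrite lie_bracket_scale// XY// Xh.
    by rewrite mulNr mulrCA mulrA addNr.
  + by move=> i p /=; rewrite YF mulr0.
- apply: (@commuting_B_integrable R n M F X (add_vf Y (scale_vf sh X))) => //.
  (* The change from [X, Y] to [X, Y + h X] is unipotent: [b = 0] comes first, and then
     [a + b h = 0] gives [a = 0]. *)
  + move=> p a b ab; have [f sf|ah b0] := hindep p (a + b * h p) b.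
      by rewrite -[RHS](ab f sf) /= mulrDr mulrDl mulrA addrAC addrA.
    by move: ah; rewrite b0 mul0r addr0.
  (* What remains is [g X f] from [[X, Y]] and [- g X f] from [X(h)], as [[X, X] = 0]. *)
  + move=> f sf p; rewrite lie_bracket_add// lie_bracket_scale//.
    by rewrite lie_bracket_self XY// Xh mulr0 addr0 mulNr subrr.
  + by move=> i p /=; rewrite XF YF mulr0 addr0.
Qed.
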